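(* Let $q$ be a prime and let $(a_1,b_1,c_1)$ be a base hit in $F_q$ with $c_1=q^{n}$, $n>1$. Put $d_1=R(a_1)$ and $w=R(Q(b_1))$, and let $y=p^{e_p}$, where $p$ is a prime dividing $w$ and $e_p>1$ is the least exponent such that $p^{e_p}\mid b_1$ and $p^{e_p}>d_1q$ (assume such $p$ and $e_p$ exist). Then there exist infinitely many $abc$ hits $(a,b,c)$ with $c=q^{e}$ a power of $q$, $R(a)=d_1$ and $c-a=b\equiv 0\pmod y$, all of them satisfying $a<q^{e}$ and $d_1R(b)<q^{e-1}$.
   Context: For a positive integer $n$, the radical is $R(n)=\prod_{p\mid n}p$ (product over the distinct primes dividing $n$), with $R(1)=1$, and $Q(n)=n/R(n)$. An $abc$ triple is a triple of pairwise coprime positive integers $(a,b,c)$ with $a+b=c$ and $1\le a<b<c$; it is an $abc$ hit if moreover $R(abc)<c$. For a squarefree integer $m>1$, $F_m$ is the set of integers $c>2$ with $R(Q(c))=m$. A base hit in $F_m$ is an $abc$ hit $(a,b,c)$ with $c\in F_m$ such that $c$ is minimal among the third entries, lying in $F_m$, of all $abc$ hits $(a',b',c')$ with $R(a')=R(a)$ and $R(b')=R(b)$. *)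

(* Defs.v *)
From mathcomp Require Import all_boot.
From mathcomp Require Import boolp classical_sets functions cardinality.
Set Implicit Arguments.
Unset Strict Implicit.
Unset Printing Implicit Defensive.

Local Open Scope classical_set_scope.
Local Open Scope nat_scope.

(* [primes 1] is empty, so [radical 1 = 1]. *)
Definition radical (n : nat) : nat := \prod_(p <- primes n) p.

Definition radical_quotient (n : nat) : nat := n %/ radical n.

Definition abc_triple (a b c : nat) : Prop :=
  [/\ 1 <= a, a < b, b < c, a + b = c
    & [/\ coprime a b, coprime a c & coprime b c]].

Definition abc_hit (a b c : nat) : Prop :=
  abc_triple a b c /\ radical (a * b * c) < c.

(* F_m, meant for m squarefree with m > 1 (m is not constrained here). *)
Definition F_family (m : nat) : set nat :=
  [set c | 2 < c /\ radical (radical_quotient c) = m].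

Definition base_hit (m a b c : nat) : Prop :=
  [/\ abc_hit a b c, F_family m c
    & forall a' b' c' : nat, abc_hit a' b' c' -> F_family m c' ->
        radical a' = radical a -> radical b' = radical b -> c <= c'].

Definition power_hit (q d y e a b c : nat) : Prop :=
  [/\ abc_hit a b c, c = q ^ e, radical a = d, c - a = b & b = 0 %[mod y]].

(* Main.v *)
Require Import Defs.
From mathcomp Require Import all_boot.
From mathcomp Require Import cyclic.
From mathcomp Require Import boolp classical_sets functions cardinality.
Set Implicit Arguments.
Unset Strict Implicit.
Unset Printing Implicit Defensive.

Local Open Scope classical_set_scope.
Local Open Scope nat_scope.

(** For an exponent [m] divisible by the totient of [p ^ (ep + 1)], Euler's
    theorem gives [q ^ (n * m) = 1 = a1 ^ m] modulo [p ^ (ep + 1)]. Put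
    [a = a1 ^ m], [c = q ^ (n * m)] and [b = c - a]. Then [R(a) = d1] and
    [R(b) <= b / p ^ ep], so that [R(abc) = d1 * R(b) * q < b] because
    [d1 * q < p ^ ep].

    Keeping [a = a1] and only increasing the exponent of [q] would not be
    enough: it guarantees only the factor [p ^ ep] in [b], hence only
    [R(b) <= b / p ^ (ep - 1)]. *)

Lemma radicalM (m n : nat) : 0 < m -> 0 < n -> coprime m n ->
  radical (m * n) = radical m * radical n.
Proof.
move=> m0 n0 cop; rewrite /radical -big_cat /=; apply: perm_big.
apply: uniq_perm; first exact: primes_uniq.
  rewrite cat_uniq !primes_uniq andbT /= -coprime_has_primes //.
by move=> r; rewrite mem_cat primesM.
Qed.

Lemma radicalX (m n : nat) : 0 < n -> radical (m ^ n) = radical m.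
Proof. by move=> n0; rewrite /radical primesX. Qed.

Lemma radical_prime (p : nat) : prime p -> radical p = p.
Proof. by move=> pp; rewrite /radical primes_prime // big_seq1. Qed.

Lemma leq_radical (n : nat) : 0 < n -> radical n <= n.
Proof.
move=> n0; rewrite {2}(prod_prime_decomp n0) prime_decompE big_map /radical.
rewrite big_seq [leqRHS]big_seq; apply: leq_prod => r.
rewrite -logn_gt0 /= => r0.
have /prime_gt0 rpos : prime r by move: r0; rewrite lognE; case: prime.
by rewrite -{1}(expn1 r) leq_pexp2l.
Qed.

(** Writing [b = x * p ^ k.+1], the numbers [b] and [x * p] have the same prime divisors, so the
    radical of [b] is at most [x * p]. One factor [p] has to stay, hence the shift from [k.+1] to
    [k]. *)
Lemma leq_radical_pfactor (p k b : nat) : prime p -> 0 < b ->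
  p ^ k.+1 %| b -> radical b * p ^ k <= b.
Proof.
move=> pp b0 /dvdnP[x bE].
have x0 : 0 < x by move: b0; rewrite bE muln_gt0 => /andP[].
have p0 := prime_gt0 pp.
have -> : radical b = radical (x * p).
  rewrite /radical; congr (\prod_(r <- _) r); apply/eq_primes => r.
  by rewrite bE !primesM ?expn_gt0 ?p0 // primesX.
by rewrite bE expnS mulnA leq_mul2r leq_radical ?orbT // muln_gt0 x0.
Qed.

Lemma radical_abc (q e a b c : nat) : prime q -> abc_triple a b c ->
  c = q ^ e -> radical (a * b * c) = radical a * radical b * q.
Proof.
move=> qq [a0 ab bc _ [cab cac cbc]] cE.
have b0 : 0 < b by apply: leq_trans ab.
(* For [e = 0] the radical of [c] would be 1 instead of [q]; this is excluded by [0 < b < c]. *)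
have e0 : 0 < e by case: e cE => // cE; move: bc; rewrite cE ltnNge b0.
have c0 : 0 < c by apply: leq_ltn_trans bc.
rewrite radicalM ?muln_gt0 ?a0 ?coprimeMl ?cac // radicalM //.
by rewrite cE radicalX // (radical_prime qq).
Qed.

Lemma eqn_mod_exp_totient (x z d m : nat) : coprime x d -> coprime z d ->
  x ^ (totient d * m) = z ^ (totient d * m) %[mod d].
Proof.
by move=> xd zd; rewrite !expnM -modnXm Euler_exp_totient // modnXm
  -[in RHS]modnXm Euler_exp_totient // modnXm.
Qed.

Lemma abc_hit_exp (q n a b p k m : nat) : prime q -> prime p ->
  abc_triple a b (q ^ n) -> p %| b -> radical a * q < p ^ k -> 0 < m ->
  let M := totient (p ^ k.+1) * m in
  [/\ abc_hit (a ^ M) ((q ^ n) ^ M - a ^ M) ((q ^ n) ^ M),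
      radical (a ^ M) = radical a
    & p ^ k.+1 %| (q ^ n) ^ M - a ^ M].
Proof.
move=> qq pp [a0 ab bc abc [cab cac cbc]] pb dk m0 M.
have M0 : 0 < M by rewrite muln_gt0 totient_gt0 expn_gt0 prime_gt0.
have aM0 : 0 < a ^ M by rewrite expn_gt0 a0.
(* This bound yields the ordering [a ^ M < B]. It follows from [2 <= 2 ^ M] and
   [a + a < a + b = q ^ n]. *)
have lt2 : a ^ M + a ^ M < (q ^ n) ^ M.
  apply: (@leq_ltn_trans ((a + a) ^ M)).
    by rewrite !addnn -!mul2n expnMn leq_mul2r -{1}(expn1 2) leq_pexp2l ?orbT.
  by rewrite ltn_exp2r // -abc ltn_add2l.
set B := _ - _.
have BE : a ^ M + B = (q ^ n) ^ M.
  by rewrite subnKC // ltnW // (leq_ltn_trans (leq_addr _ _) lt2).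
have aB : a ^ M < B by rewrite -(ltn_add2l (a ^ M)) BE.
have B0 : 0 < B by apply: leq_trans aB.
have BltC : B < (q ^ n) ^ M by rewrite -BE -[ltnLHS]add0n ltn_add2r.
have dB : p ^ k.+1 %| B.
  rewrite -eqn_mod_dvd; last by rewrite -BE leq_addr.
  (* Since [p] divides [b], which is coprime to both [a] and [q ^ n], Euler's theorem applies to
     both bases. *)
  apply/eqP/eqn_mod_exp_totient; rewrite coprime_sym coprimeXl //.
    exact: coprime_dvdl pb cbc.
  by rewrite coprime_sym (coprime_dvdr pb).
have cAC : coprime (a ^ M) ((q ^ n) ^ M) by rewrite coprimeXl // coprimeXr.
have cAB : coprime (a ^ M) B by rewrite /coprime -gcdnDl BE.
have T : abc_triple (a ^ M) B ((q ^ n) ^ M).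
  by split=> //; split=> //; rewrite /coprime -BE gcdnDr gcdnC.
split=> //; last exact: radicalX.
split=> //; rewrite (radical_abc qq T (esym (expnM q n M))) radicalX //.
(* The chain is [radical a * q * radical B <= p ^ k * radical B <= B < (q ^ n) ^ M]. *)
apply: leq_ltn_trans BltC; rewrite mulnAC.
apply: leq_trans (leq_radical_pfactor pp B0 dB).
by rewrite mulnC leq_mul2l ltnW ?orbT.
Qed.

Theorem proposition9 (q : nat) (hq : prime q)
  (a1 b1 c1 : nat) (hbase : base_hit q a1 b1 c1)
  (n : nat) (hn : 1 < n) (hc1 : c1 = q ^ n)
  (d1 w : nat) (hd1 : d1 = radical a1) (hw : w = radical (radical_quotient b1))
  (p : nat) (hp : prime p) (hpw : p %| w)
  (ep : nat) (hep : [/\ 1 < ep, p ^ ep %| b1 & d1 * q < p ^ ep])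
  (hepmin : forall k : nat, [/\ 1 < k, p ^ k %| b1 & d1 * q < p ^ k] -> ep <= k)
  (y : nat) (hy : y = p ^ ep) :
  infinite_set
    [set t : nat * nat * nat | exists e : nat, power_hit q d1 y e t.1.1 t.1.2 t.2]
  /\ (forall e a b c : nat, power_hit q d1 y e a b c ->
        a < q ^ e /\ d1 * radical b < q ^ (e - 1)).
Proof.
case: hbase => -[T1 _] _ _; rewrite hc1 in T1.
case: hep => ep1 pepb dk; rewrite hd1 in dk.
have pb : p %| b1.
  by apply: dvdn_trans pepb; apply: dvdn_exp => //; apply: ltnW.
split; last first.
  move=> e a b c [[T R] cE ra _ _].
  have [a0 ab bc _ _] := T.
  split; first by rewrite -cE (ltn_trans ab).
  (* The hit inequality reads [d1 * radical b * q < q ^ e]; it remains to cancel one [q], the case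
     [e = 0] being impossible since then [c = 1]. *)
  move: R; rewrite (radical_abc hq T cE) ra cE.
  case: e cE => [cE|e _]; first by move: bc; rewrite cE ltnNge (leq_trans _ ab).
  by rewrite expnSr ltn_mul2r subn1 => /andP[].
pose M j := totient (p ^ ep.+1) * j.+1.
pose f j := (a1 ^ M j, (q ^ n) ^ M j - a1 ^ M j, (q ^ n) ^ M j).
have phi0 : 0 < totient (p ^ ep.+1) by rewrite totient_gt0 expn_gt0 prime_gt0.
have qn1 : 1 < q ^ n by rewrite -(expn0 q) ltn_exp2l ?prime_gt1 // ltnW.
have f_inj : injective f.
  move=> i j [_ _ /eqP]; rewrite eqn_exp2l // eqn_pmul2l //.
  by move=> /eqP[].
(* Every [f j] lies in the set of hits, so if that set were finite, its preimage under the injective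
   [f], all of [nat], would be finite too. *)
move=> fin; apply: infinite_nat.
apply: sub_finite_set (@finite_preimage _ _ _ f (in2W f_inj) fin) => j _ /=.
have [hit ra dvd] := abc_hit_exp hq hp T1 pb dk (ltn0Sn j).
exists (n * M j); split=> //=; [by rewrite expnM | by rewrite ra hd1 |].
by rewrite mod0n hy; apply/eqP; apply: dvdn_trans dvd; apply: dvdn_exp2l.
Qed.
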